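(* Let $A(n)$ be the number of three-colored partitions in $\Gamma$ that sum to a non-negative integer $n$ with no occurrences of $1_R$. Then, as formal power series in $q$, $$\sum_{n \ge 0} A(n) q^n = \frac{1}{\left(q;q^2\right)_\infty\left(q^1,q^4;q^5\right)_\infty}.$$
   Context: A partition of $n$ is a finite non-increasing sequence of positive integers (called parts) that sums to $n$ (the empty partition is the unique partition of $0$). A three-colored partition is a partition in which each part is assigned one of three colors $R$, $G$, $B$; parts that are the same integer but have different colors are considered distinct. A part of size $j$ is written $j_R$, $j_G$ or $j_B$ according to its color, and its contribution to the sum is $j$. The order of the parts is immaterial (a colored partition is a finite multiset of colored parts). $\Gamma$ is the set of three-colored partitions (colors $R$, $G$, $B$) satisfying the following conditions: (i) The sizes of all parts are distinct: for every $j\ge 1$, there is at most one part in total among all copies of $j_R$, $j_G$, $j_B$. (ii) For every $j\ge 1$, none of the following pairs of parts occur together in the partition: $j_R$ and $(j+1)_R$; $j_R$ and $(j+2)_R$; $j_R$ and $(j+1)_B$; $j_G$ and $(j+1)_R$; $j_G$ and $(j+2)_R$; $j_G$ and $(j+1)_B$; $j_B$ and $(j+1)_R$; $j_B$ and $(j+1)_G$. Here $q$ is a formal variable, $(a;q)_\infty = \prod_{j=1}^{\infty}(1-aq^{j-1})$, and $(a_1,\dots,a_k;q)_\infty=(a_1;q)_\infty\cdots(a_k;q)_\infty$. Thus $(q;q^2)_\infty=\prod_{m\ge0}(1-q^{2m+1})$ and $(q^1,q^4;q^5)_\infty=\prod_{m\ge0}(1-q^{5m+1})(1-q^{5m+4})$.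 *)

(* Defs.v *)
(* MathComp, with the classical layer of MathComp-Analysis. *)
From HB Require Import structures.
From mathcomp Require Import all_boot all_algebra.
From mathcomp Require Import finmap multiset.
From mathcomp Require Import boolp classical_sets cardinality.

Set Implicit Arguments.
Unset Strict Implicit.
Unset Printing Implicit Defensive.

Import GRing.Theory.

Local Open Scope ring_scope.

Record fps (R : Type) : Type := Fps { fps_coef : nat -> R }.

Lemma fpsP (R : Type) (f g : fps R) : fps_coef f =1 fps_coef g -> f = g.
Proof. by case: f g => f [g] /= /funext->. Qed.

HB.instance Definition _ (R : Type) := gen_eqMixin (fps R).
HB.instance Definition _ (R : Type) := gen_choiceMixin (fps R).

Section Zmodule.
Variable R : zmodType.
Implicit Types f g h : fps R.

Definition fps_zero : fps R := Fps (fun=> 0).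
Definition fps_add f g : fps R := Fps (fun n => fps_coef f n + fps_coef g n).
Definition fps_opp f : fps R := Fps (fun n => - fps_coef f n).

Fact fps_addA : associative fps_add.
Proof. by move=> f g h; apply: fpsP => n /=; rewrite addrA. Qed.
Fact fps_addC : commutative fps_add.
Proof. by move=> f g; apply: fpsP => n /=; rewrite addrC. Qed.
Fact fps_add0 : left_id fps_zero fps_add.
Proof. by move=> f; apply: fpsP => n /=; rewrite add0r. Qed.
Fact fps_addN : left_inverse fps_zero fps_opp fps_add.
Proof. by move=> f; apply: fpsP => n /=; rewrite addNr. Qed.

HB.instance Definition _ :=
  GRing.isZmodule.Build (fps R) fps_addA fps_addC fps_add0 fps_addN.
End Zmodule.

Section Ring.
Variable R : comNzRingType.
Implicit Types f g h : fps R.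

Definition fps_one : fps R := Fps (fun n => (n == 0%N)%:R).
Definition fps_mul f g : fps R :=
  Fps (fun n => \sum_(i < n.+1) fps_coef f i * fps_coef g (n - i)).

Let trunc n f : {poly R} := \poly_(i < n.+1) fps_coef f i.

Let truncM n f g k : (k <= n)%N ->
  (trunc n f * trunc n g)`_k = fps_coef (fps_mul f g) k.
Proof.
move=> le_kn; rewrite coefM; apply: eq_bigr => -[i /=]; rewrite ltnS => le_ik _.
by rewrite !coef_poly !ltnS (leq_trans le_ik) ?(leq_trans (leq_subr _ _)).
Qed.

Let coef_mulE n (f g : fps R) (p r : {poly R}) :
    (forall i, (i <= n)%N -> p`_i = fps_coef f i) ->
    (forall i, (i <= n)%N -> r`_i = fps_coef g i) ->
  fps_coef (fps_mul f g) n = (p * r)`_n.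
Proof.
move=> pE rE; rewrite coefM; apply: eq_bigr => -[i /=]; rewrite ltnS => le_in _.
by rewrite pE // rE // leq_subr.
Qed.

Let truncE n f i : (i <= n)%N -> (trunc n f)`_i = fps_coef f i.
Proof. by move=> le_in; rewrite coef_poly ltnS le_in. Qed.

Fact fps_mulC : commutative fps_mul.
Proof.
move=> f g; apply: fpsP => n.
by rewrite -!(truncM _ _ (leqnn n)) mulrC.
Qed.

Fact fps_mulA : associative fps_mul.
Proof.
move=> f g h; apply: fpsP => n.
rewrite (coef_mulE (@truncE n f) (@truncM n g h)).
by rewrite (coef_mulE (@truncM n f g) (@truncE n h)) mulrA.
Qed.

Fact fps_mul1 : left_id fps_one fps_mul.
Proof.
move=> f; apply: fpsP => n /=.
by rewrite big_ord_recl /= mul1r subn0 big1 ?addr0 // => i _; rewrite mul0r.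
Qed.

Fact fps_mulDl : left_distributive fps_mul (@fps_add R).
Proof.
move=> f g h; apply: fpsP => n /=; rewrite -big_split.
by apply: eq_bigr => i _; rewrite mulrDl.
Qed.

Fact fps_one_neq0 : fps_one != 0.
Proof.
by apply/eqP => /(congr1 (fun f => fps_coef f 0)) /eqP; rewrite oner_eq0.
Qed.

HB.instance Definition _ := GRing.Zmodule_isComNzRing.Build (fps R)
  fps_mulA fps_mulC fps_mul1 fps_mulDl fps_one_neq0.

Definition fps_unit : pred (fps R) := fun f => `[< exists g, g * f = 1 >].
Definition fps_inv f : fps R :=
  if fps_unit f then xget f [set g | g * f = 1] else f.

Fact fps_mulV : {in fps_unit, left_inverse 1 fps_inv *%R}.
Proof.
move=> f f_unit; have fu : fps_unit f = true := f_unit; rewrite /fps_inv fu.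
by have /asboolP[g gf1] := fu; case: xgetP => [h _|/(_ g)].
Qed.
Fact fps_unitP f g : g * f = 1 -> fps_unit f.
Proof. by move=> gf1; apply/asboolP; exists g. Qed.
Fact fps_inv_out : {in [predC fps_unit], fps_inv =1 id}.
Proof. by move=> f f_nunit; rewrite /fps_inv ifN //; exact: f_nunit. Qed.

HB.instance Definition _ := GRing.ComNzRing_hasMulInverse.Build (fps R)
  fps_mulV fps_unitP fps_inv_out.

Lemma fps_mul_low f g k m : (forall i, (i < k)%N -> fps_coef f i = 0) ->
  (forall i, (i < m)%N -> fps_coef g i = 0) ->
  forall i, (i < k + m)%N -> fps_coef (f * g) i = 0.
Proof.
move=> fk gm i lt_i; apply: big1 => -[j /=]; rewrite ltnS => le_ji _.
have [/fk->|le_kj] := ltnP j k; first by rewrite mul0r.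
by rewrite gm ?mulr0 // ltn_subLR // (leq_trans lt_i) // leq_add2r.
Qed.

Lemma fps_exp_low b N : fps_coef b 0 = 0 ->
  forall i, (i < N)%N -> fps_coef (b ^+ N) i = 0.
Proof.
move=> b0; elim: N => // N IH i lt_i; rewrite exprS.
by apply: (@fps_mul_low b (b ^+ N) 1 N) => // -[].
Qed.

Lemma fps_unit1 f : fps_coef f 0 = 1 -> f \is a GRing.unit.
Proof.
move=> f0; set h := 1 - f.
have h0 : fps_coef h 0 = 0 by rewrite -[LHS]/(1 - fps_coef f 0) f0 subrr.
apply/asboolP; have fE : f = 1 - h by rewrite /h opprB addrC subrK.
pose v n := \sum_(i < n.+1) h ^+ i.
have vE n N : (n <= N)%N -> fps_coef (v N) n = fps_coef (v n) n.
  elim: N => [|N IH]; first by rewrite leqn0 => /eqP->.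
  rewrite leq_eqVlt => /orP[/eqP-> //|lt_n].
  rewrite /v big_ord_recr /= -/(v N).
  rewrite -[LHS]/(fps_coef (v N) n + fps_coef (h ^+ N.+1) n).
  by rewrite fps_exp_low // addr0 IH.
exists (Fps (fun n => fps_coef (v n) n)); apply: fpsP => n.
transitivity (fps_coef (v n * f) n).
  by apply: eq_bigr => -[i /= lt_i] _; rewrite vE.
have -> : v n * f = 1 - h ^+ n.+1.
  by rewrite fE -[1 in RHS](expr1n _ n.+1) subrXX mulrC; congr (_ * _);
    apply: eq_bigr => i _; rewrite expr1n mul1r.
rewrite -[LHS]/(fps_coef 1 n - fps_coef (h ^+ n.+1) n).
by rewrite fps_exp_low // subr0.
Qed.

Definition fps_q : fps R := Fps (fun n => (n == 1%N)%:R).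

(* q-adic convergence: each coefficient is eventually constant. *)
Definition fps_cvg_to (u : nat -> fps R) f :=
  forall n, exists N0, forall N, (N0 <= N)%N -> fps_coef (u N) n = fps_coef f n.

Definition fps_lim (u : nat -> fps R) : fps R :=
  xget 0 [set f | fps_cvg_to u f].

Lemma fps_cvg_unique u f g : fps_cvg_to u f -> fps_cvg_to u g -> f = g.
Proof.
move=> uf ug; apply: fpsP => n; have [[N uN] [M uM]] := (uf n, ug n).
by rewrite -(uN (maxn N M)) ?leq_maxl // uM ?leq_maxr.
Qed.

Lemma fps_limE u f : fps_cvg_to u f -> fps_lim u = f.
Proof.
move=> uf; rewrite /fps_lim; case: xgetP => [g _ ug|/(_ f) //].
exact: fps_cvg_unique ug uf.
Qed.

(* (a; b)_oo as a q-adic limit; it exists whenever b has no constant term,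
   see [qpoch_cvg]. *)
Definition qpoch (a b : fps R) : fps R :=
  fps_lim (fun N => \prod_(1 <= j < N.+1) (1 - a * b ^+ (j - 1))).

Lemma qpoch_cvg a b : fps_coef b 0 = 0 ->
  fps_cvg_to (fun N => \prod_(1 <= j < N.+1) (1 - a * b ^+ (j - 1))) (qpoch a b).
Proof.
move=> b0; pose u N := \prod_(1 <= j < N.+1) (1 - a * b ^+ (j - 1)).
have uS N n : (n < N)%N -> fps_coef (u N.+1) n = fps_coef (u N) n.
  move=> lt_n.
  have -> : u N.+1 = u N - u N * (a * b ^+ N).
    by rewrite {1}/u big_nat_recr //= subn1 mulrBr mulr1.
  rewrite -[LHS]/(fps_coef (u N) n - fps_coef (u N * (a * b ^+ N)) n).
  rewrite mulrA (@fps_mul_low (u N * a) (b ^+ N) 0 N) ?subr0 //.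
  exact: fps_exp_low.
have uf : fps_cvg_to u (Fps (fun n => fps_coef (u n.+1) n)).
  move=> n; exists n.+1; elim=> // N IH; rewrite leq_eqVlt => /orP[/eqP<- //|].
  by rewrite ltnS => h; rewrite uS //; apply: IH.
by rewrite /qpoch (fps_limE uf : fps_lim _ = _).
Qed.

Definition qpochs (s : seq (fps R)) (b : fps R) : fps R :=
  \prod_(a <- s) qpoch a b.

End Ring.

Local Close Scope ring_scope.

Variant color := Red | Green | Blue.

Definition color_ord (c : color) : 'I_3 :=
  match c with Red => inord 0 | Green => inord 1 | Blue => inord 2 end.
Definition ord_color (i : 'I_3) : color :=
  match val i with 0 => Red | 1 => Green | _ => Blue end.
Fact color_ordK : cancel color_ord ord_color.
Proof. by case; rewrite /ord_color /= inordK. Qed.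

HB.instance Definition _ := Finite.copy color (can_type color_ordK).

(* (j, c) is the part j_c; positivity of j is required in
   [colored_partition]. *)
Definition part : Type := nat * color.
HB.instance Definition _ := Choice.on part.

Local Open Scope mset_scope.

Definition colored_partition (p : {mset part}) : Prop :=
  forall x, x \in p -> 0 < x.1.

Definition weight (p : {mset part}) : nat := \sum_(x <- p) x.1.

Definition distinct_sizes (p : {mset part}) : Prop :=
  forall j, 1 <= j -> p (j, Red) + p (j, Green) + p (j, Blue) <= 1.

(* (c, d, c') stands for the pairs j_c, (j+d)_c'. *)
Definition forbidden_pairs : seq (color * nat * color) :=
  [:: (Red, 1, Red); (Red, 2, Red); (Red, 1, Blue);
      (Green, 1, Red); (Green, 2, Red); (Green, 1, Blue);
      (Blue, 1, Red); (Blue, 1, Green)].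

Definition no_forbidden_pair (p : {mset part}) : Prop :=
  forall j c d c', 1 <= j -> (c, d, c') \in forbidden_pairs ->
    ~ ((j, c) \in p /\ (j + d, c') \in p).

Definition Gamma (p : {mset part}) : Prop :=
  [/\ colored_partition p, distinct_sizes p & no_forbidden_pair p].

Definition Gamma_no1R (n : nat) : set {mset part} :=
  [set p | [/\ Gamma p, weight p = n & (1, Red) \notin p]]%classic.

(* [fset_set], used to count below, is only meaningful on finite sets. *)
Lemma finite_Gamma_no1R (n : nat) : finite_set (Gamma_no1R n).
Proof.
pose g (s : n.-bseq ('I_n.+1 * color)) : {mset part} :=
  seq_mset [seq (val x.1, x.2) : part | x <- s].
apply: (@sub_finite_set _ _ (g @` [set: _])%classic); last first.
  exact/finite_image/finite_finset.
move=> p [[p_gt0 _ _] wp _].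
have p_le x : x \in p -> x.1 <= n.
  by rewrite -wp /weight => px; rewrite (big_rem x) //= leq_addr.
have size_p : size p <= n.
  rewrite -wp /weight -sum1_size big_seq [leqRHS]big_seq.
  by apply: leq_sum => x /p_gt0.
pose s := [seq (inord x.1 : 'I_n.+1, x.2) | x <- (p : seq part)].
have size_s : size s <= n by rewrite size_map.
exists (Bseq size_s) => //; rewrite /g /= -map_comp -[RHS]seq_mset_id.
congr seq_mset; rewrite -[RHS]map_id; apply/eq_in_map => -[j c] px /=.
by rewrite inordK // ltnS (p_le _ px).
Qed.

Definition A (n : nat) : nat := #|` fset_set (Gamma_no1R n)|.

(* Main.v *)
(* Reading the colors of the sizes 1, 2, 3, ... as a word, Gamma is the language
   of a finite automaton, so the generating functions of the partitions with
   parts larger than j, indexed by the state reached, satisfy a linear system of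
   q-difference equations. Elimination leaves one equation of order three in
   x = q^j, solved by
     e(x) = \sum_k x^k q^(k^2) (-q; q)_k / (q; q)_k (-x q^k; q)_oo,
   and the series in which 1_R is forbidden is
     e(1) - e(q) = (-q; q)_oo \sum_k q^(k^2) / (q; q)_k.
   Euler's identity handles the first factor. The second one is the first
   Rogers-Ramanujan sum: the Bailey lemma applied twice to the unit Bailey pair
   turns it into a theta series, which the Jacobi triple product factors. Both
   the unit Bailey pair and the triple product are instances of the same finite
   identity. *)
Require Import Defs.
From mathcomp Require Import all_boot all_algebra.
From mathcomp Require Import finmap multiset.
From mathcomp Require Import boolp classical_sets cardinality.
From mathcomp Require Import ring zify.

Set Implicit Arguments.
Unset Strict Implicit.
Unset Printing Implicit Defensive.

Import GRing.Theory.

Local Open Scope ring_scope.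

(** * Finite q-series identities *)

Section Pochhammer.
Variable R : comUnitRingType.
Implicit Types (p a z w : R) (n k r : nat).

(* The finite product (a; p)_n. *)
Definition fpoch a p n : R := \prod_(i < n) (1 - a * p ^+ i).

Lemma fpoch0 a p : fpoch a p 0 = 1.
Proof. by rewrite /fpoch big_ord0. Qed.

Lemma fpochS a p n : fpoch a p n.+1 = fpoch a p n * (1 - a * p ^+ n).
Proof. by rewrite /fpoch big_ord_recr. Qed.

Lemma fpochSl a p n : fpoch a p n.+1 = (1 - a) * fpoch (a * p) p n.
Proof.
rewrite /fpoch big_ord_recl expr0 mulr1; congr (_ * _); apply: eq_bigr => i _.
by rewrite /= exprS mulrA.
Qed.

(** The exponents 1, ..., mn are sorted by residue mod m; this splits (q; q)_oo mod 2 and mod 5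
    below. *)
Lemma fpoch_dissect p m n : (0 < m)%N ->
  fpoch p p (m * n) = \prod_(i < m) fpoch (p ^+ i.+1) (p ^+ m) n.
Proof.
move=> m_gt0; elim: n => [|n IHn].
  by rewrite muln0 fpoch0 big1 // => i _; rewrite fpoch0.
under eq_bigr do rewrite fpochS; rewrite big_split -IHn /= mulnS addnC.
rewrite /fpoch big_split_ord /=; congr (_ * _); apply: eq_bigr => i _.
by rewrite -exprS -exprM -exprD addSn addnC.
Qed.

(** * Bailey pairs and the finite Jacobi triple product *)

Section Bailey.
Variable p : R.
Hypothesis p_unit : forall n, 1 - p ^+ n.+1 \is a GRing.unit.

Definition inv_qfact n : R := (fpoch p p n)^-1.
Local Notation V := inv_qfact.

Lemma fpoch_unit n : fpoch p p n \is a GRing.unit.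
Proof.
by elim: n => [|n IHn]; rewrite ?fpoch0 ?unitr1 // fpochS unitrM IHn -exprS p_unit.
Qed.

Lemma inv_qfact0 : V 0 = 1. Proof. by rewrite /inv_qfact fpoch0 invr1. Qed.

(** Oriented to raise the index: once every [V] is brought to the largest index in sight, [ring] can
    finish without division. *)
Lemma inv_qfactS n : V n = (1 - p ^+ n.+1) * V n.+1.
Proof.
rewrite /inv_qfact fpochS -exprS invrM ?fpoch_unit ?p_unit //.
by rewrite mulVKr ?p_unit.
Qed.

(** The q-Chu-Vandermonde sum in the limit where one upper index is infinite, by induction on M for
    all L at once. *)
Lemma q_vandermonde M L :
  \sum_(k < M.+1) p ^+ (k * (k + L)) * V (M - k) * V k * V (k + L) =
  V M * V (M + L).
Proof.
elim: M L => [|M IHM] L.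
  by rewrite big_ord1 mul0n expr0 subn0 inv_qfact0 add0n !mul1r.
apply: (mulrI (p_unit M)).
transitivity (V M * V (M + L) + p ^+ (M.+1 + L) * (V M * V (M + L.+1))); last first.
  by rewrite [in LHS]inv_qfactS [V (M + L)]inv_qfactS addnS addSn; ring.
rewrite -!IHM !mulr_sumr.
rewrite [X in _ = X + _](_ : _ = \sum_(k < M.+2) p ^+ (k * (k + L)) *
    ((1 - p ^+ (M.+1 - k)) * V (M.+1 - k)) * V k * V (k + L)); last first.
  rewrite [in RHS]big_ord_recr /= subnn expr0 subrr mul0r mulr0 !mul0r addr0.
  by apply: eq_bigr => -[k /= lek] _; rewrite subSn // -inv_qfactS.
rewrite [X in _ = _ + X](_ : _ = \sum_(k < M.+2) p ^+ (k * (k + L)) *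
    V (M.+1 - k) * (p ^+ (M.+1 - k) * (1 - p ^+ k) * V k) * V (k + L)); last first.
  rewrite [in RHS]big_ord_recl /= expr0 subrr mulr0 mul0r mulr0 mul0r add0r.
  apply: eq_bigr => -[k /= lek] _; rewrite [in RHS]/bump /= add1n subSS.
  rewrite -[p ^+ (M - k) * _ * _]mulrA -inv_qfactS [(k.+1 + L)%N]addSnnS.
  have -> : p ^+ (k.+1 * (k + L.+1)) * V (M - k) * (p ^+ (M - k) * V k) *
      V (k + L.+1) =
    (p ^+ (k.+1 * (k + L.+1)) * p ^+ (M - k)) * V (M - k) * V k * V (k + L.+1).
    by ring.
  rewrite -exprD !mulrA -exprD; congr (p ^+ _ * _ * _ * _); nia.
rewrite -big_split; apply: eq_bigr => -[k /= lek] _.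
by rewrite -{1}(subnK (_ : k <= M.+1)%N) // exprD; ring.
Qed.

(** Bailey pairs relative to a = 1. *)
Definition bailey_pair (alpha beta : nat -> R) : Prop :=
  forall n, beta n = \sum_(0 <= r < n.+1) alpha r * (V (n - r) * V (n + r)).

(** The case rho_1, rho_2 -> oo of Bailey's lemma. Once the two sums are exchanged, the inner one,
    with s = r + k, is [q_vandermonde] at M = n - r, L = 2r. *)
Lemma bailey_lemma alpha beta : bailey_pair alpha beta ->
  bailey_pair (fun r => p ^+ (r ^ 2) * alpha r)
    (fun n => \sum_(0 <= s < n.+1) p ^+ (s ^ 2) * V (n - s) * beta s).
Proof.
move=> ab n.
transitivity (\sum_(0 <= s < n.+1) \sum_(0 <= r < n.+1 | (r <= s)%N)
    alpha r * (p ^+ (s ^ 2) * V (n - s) * V (s - r) * V (s + r))).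
  rewrite big_nat [RHS]big_nat; apply: eq_bigr => s /andP[_ lt_sn].
  rewrite ab mulr_sumr (big_nat_widen _ _ n.+1) //.
  apply: eq_big => [r|r _]; first by rewrite /= ltnS.
  by ring.
rewrite (exchange_big_dep_nat xpredT) //=; apply: eq_big_nat => r /andP[_ lt_rn].
rewrite -mulr_sumr.
have -> : \sum_(0 <= s < n.+1 | (r <= s)%N)
      p ^+ (s ^ 2) * V (n - s) * V (s - r) * V (s + r) =
    \sum_(0 <= k < (n - r).+1)
      p ^+ (r ^ 2) *
        (p ^+ (k * (k + r.*2)) * V (n - r - k) * V k * V (k + r.*2)).
  rewrite (big_cat_nat (n := r)) //=; last by lia.
  rewrite big_nat_cond big1 ?add0r; last by move=> s; lia.
  rewrite -{1}(add0n r) big_addn subSn // big_mkcond; apply: eq_bigr => k _.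
  rewrite leq_addl addnK !mulrA -exprD.
  by congr (p ^+ _ * V _ * V _ * V _); nia.
rewrite -mulr_sumr big_mkord q_vandermonde.
by rewrite (_ : n - r + r.*2 = n + r)%N; [ring | lia].
Qed.

(* [V (n - r) * V (n + r)], extended by 0 beyond the truncation of [n - r]. *)
Let S n r : R := if (r <= n)%N then V (n - r) * V (n + r) else 0.

(** Times (p; p)_{2n}, [S n r] is the Gaussian binomial with upper index 2n and lower index n - r;
    this is the q-Pascal rule applied twice. *)
Let S_double_pascal n r : (r <= n)%N ->
  (1 - p ^+ n.*2.+1) * (1 - p ^+ n.*2.+2) * S n.+1 r.+1 =
  (1 + p ^+ n.*2.+1) * S n r.+1 + p ^+ (n - r) * S n r +
  p ^+ (n + r).+2 * S n r.+2.
Proof.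
rewrite leq_eqVlt => /orP[/eqP <-|lt_rn].
  rewrite /S !ltnn !leqnn ltnNge leqnSn /= !subnn addnS addSn addnn inv_qfact0 expr0.
  by rewrite [V r.*2]inv_qfactS [V r.*2.+1]inv_qfactS; ring.
have [m ->] : exists m, n = (r + m).+1 by exists (n - r).-1; lia.
(* The factor 1 - p^m vanishes at m = 0, exactly where [S] is 0 by convention, so one formula covers
   both cases. *)
have -> : S (r + m).+1 r.+2 = (1 - p ^+ m) * V m * V (r.*2 + m).+3.
  rewrite /S; case: m => [|m]; first by rewrite addn0 ltnn subrr !mul0r.
  rewrite -inv_qfactS ifT; last by lia.
  by congr (V _ * V _); lia.
rewrite /S !ifT; try lia.
rewrite (_ : (r + m).+2 - r.+1 = m.+1)%N; last lia.
rewrite (_ : (r + m).+2 + r.+1 = (r.*2 + m).+3)%N; last lia.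
rewrite (_ : (r + m).+1 - r.+1 = m)%N; last lia.
rewrite (_ : (r + m).+1 + r.+1 = (r.*2 + m).+2)%N; last lia.
rewrite (_ : (r + m).+1 - r = m.+1)%N; last lia.
rewrite (_ : (r + m).+1 + r = (r.*2 + m).+1)%N; last lia.
rewrite [V m]inv_qfactS [V (r.*2 + m).+1]inv_qfactS [V (r.*2 + m).+2]inv_qfactS.
by rewrite -!muln2 !(exprS, exprD, exprM, mulnDl); ring.
Qed.

(** The case r = -1 of the rule: the neighbours 1 and -1 of index 0 agree by symmetry, whence the
    factor 2. *)
Let S_double_pascal0 n :
  (1 - p ^+ n.*2.+1) * (1 - p ^+ n.*2.+2) * S n.+1 0 =
  (1 + p ^+ n.*2.+1) * S n 0 + 2 * p ^+ n.+1 * S n 1.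
Proof.
rewrite /S /= !subn0 !addn0.
have -> : (if (0 < n)%N then V (n - 1) * V (n + 1) else 0) =
    (1 - p ^+ n) * V n * V n.+1.
  case: n => [|n]; first by rewrite subrr !mul0r.
  by rewrite -inv_qfactS subn1 addn1.
by rewrite [V n]inv_qfactS -!muln2 !(exprS, exprM); ring.
Qed.

(** For zw = p, the terms r and -r of the bilateral series of (-1)^r z^r p^(r(r-1)/2) folded
    together, which avoids negative powers. *)
Definition theta_coef z w r : R :=
  (-1) ^+ r * p ^+ 'C(r, 2) * (if r == 0%N then 1 else z ^+ r + w ^+ r).

(** The coefficient of index r - 1 as the recurrence sees it: index 0 is reached from both 1 and -1,
    hence 2, and from index 0 every move goes outwards. *)
Let theta_prev z w r : R :=
  if r is r1.+1 then (if r1 == 0%N then 2 else theta_coef z w r1) else 0.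

(** On bilateral terms, multiplication by -z raises the index and by -w = -p/z lowers it, each up to
    a power of p. *)
Let theta_coef_rec z w n r : z * w = p -> (r <= n)%N ->
  - ((z + w) * p ^+ n * theta_coef z w r) =
  p ^+ (n - r) * theta_coef z w r.+1 + p ^+ (n + r) * theta_prev z w r.
Proof.
move=> zw le_rn.
have -> : p ^+ n = p ^+ (n - r) * p ^+ r by rewrite -exprD subnK.
have -> : p ^+ (n + r) = p ^+ (n - r) * p ^+ r * p ^+ r.
  by rewrite -!exprD subnK.
move: (p ^+ (n - r)) => u {le_rn}.
case: r => [|[|r]]; rewrite /theta_prev /theta_coef /= ?binS ?bin0 ?bin1.
- by ring.
- by rewrite -zw; ring.
- by rewrite !(exprS, exprD) -zw; ring.
Qed.

(** Cauchy's finite form of the triple product. In the induction the new factor is (1 - z p^n)(1 - w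
    p^n) = 1 + p^(2n+1) - (z + w) p^n; [theta_coef_rec] and [S_double_pascal] spread the two sides
    over neighbouring indices in the same way. At z = 1 the product vanishes for n > 0: the unit
    Bailey pair. *)
Lemma finite_jacobi_triple z w : z * w = p ->
  bailey_pair (theta_coef z w) (fun n => V n.*2 * fpoch z p n * fpoch w p n).
Proof.
move=> zw n.
transitivity (\sum_(0 <= r < n.+1) theta_coef z w r * S n r); last first.
  by rewrite big_nat [RHS]big_nat; apply: eq_bigr => r /=; rewrite /S ltnS => ->.
elim: n => [|n IHn].
  rewrite big_nat1 /S /theta_coef /= !fpoch0 inv_qfact0 bin_small // !expr0.
  by ring.
apply: (mulrI (p_unit n.*2)); apply: (mulrI (p_unit n.*2.+1)).
rewrite doubleS !fpochS.
transitivity ((1 - z * p ^+ n) * (1 - w * p ^+ n) *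
    \sum_(0 <= r < n.+1) theta_coef z w r * S n r).
  by rewrite -IHn [V n.*2]inv_qfactS [V n.*2.+1]inv_qfactS; ring.
transitivity ((1 + p ^+ n.*2.+1) * \sum_(0 <= r < n.+1) theta_coef z w r * S n r
   + \sum_(0 <= r < n.+1) - ((z + w) * p ^+ n * theta_coef z w r) * S n r).
  rewrite [X in _ = _ + X](eq_bigr (fun r =>
    - ((z + w) * p ^+ n) * (theta_coef z w r * S n r))); last by move=> r _; ring.
  rewrite -mulr_sumr -mulrDl; congr (_ * _).
  by rewrite -muln2 exprS exprM; move: (p ^+ n) => u; rewrite -zw; ring.
have S0 r : (n < r)%N -> S n r = 0 by move=> lt_nr; rewrite /S leqNgt lt_nr.
have -> : \sum_(0 <= r < n.+1) theta_coef z w r * S n r =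
    theta_coef z w 0 * S n 0 +
    \sum_(0 <= r < n.+1) theta_coef z w r.+1 * S n r.+1.
  rewrite -(big_nat_recl n.+1 0 (fun r => theta_coef z w r * S n r)) //.
  by rewrite [RHS]big_nat_recr //= S0 // mulr0 addr0.
have -> : \sum_(0 <= r < n.+1) - ((z + w) * p ^+ n * theta_coef z w r) * S n r =
    \sum_(0 <= r < n.+1) theta_coef z w r.+1 * (p ^+ (n - r) * S n r) +
    2 * p ^+ n.+1 * S n 1 +
    \sum_(0 <= r < n.+1) theta_coef z w r.+1 * (p ^+ (n + r).+2 * S n r.+2).
  (* [f] gathers the contributions that lower the index. It vanishes at r = 0 and for r > n; its
     term r = 1 is the doubled one landing on index 0. *)
  pose f r := p ^+ (n + r) * theta_prev z w r * S n r.
  have f0 : f 0%N = 0 by rewrite /f /= mulr0 mul0r.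
  have -> : 2 * p ^+ n.+1 * S n 1 = f 1%N by rewrite /f /= addn1; ring.
  have -> : \sum_(0 <= r < n.+1) theta_coef z w r.+1 *
      (p ^+ (n + r).+2 * S n r.+2) = \sum_(0 <= r < n.+1) f r.+2.
    by apply: eq_bigr => r _; rewrite /f /= !addnS; ring.
  have fE : \sum_(0 <= r < n.+1) f r =
      f 1%N + \sum_(0 <= r < n.+1) f r.+2.
    transitivity (\sum_(0 <= r < n.+3) f r).
      rewrite [RHS]big_nat_recr // [X in _ = X + _]big_nat_recr //=.
      by rewrite /f !S0 // !mulr0 !addr0.
    by rewrite big_nat_recl // f0 add0r big_nat_recl.
  rewrite -addrA -fE -big_split /=.
  rewrite big_nat [RHS]big_nat; apply: eq_bigr => r /=; rewrite ltnS => le_rn.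
  by rewrite theta_coef_rec // /f; ring.
have -> : \sum_(0 <= r < n.+2) theta_coef z w r * S n.+1 r =
    theta_coef z w 0 * S n.+1 0 +
    \sum_(0 <= r < n.+1) theta_coef z w r.+1 * S n.+1 r.+1.
  exact: big_nat_recl.
rewrite !mulrDr !mulr_sumr.
have sumE r : (0 <= r < n.+1)%N ->
    (1 - p ^+ n.*2.+2) *
      ((1 - p ^+ n.*2.+1) * (theta_coef z w r.+1 * S n.+1 r.+1)) =
    (1 + p ^+ n.*2.+1) * (theta_coef z w r.+1 * S n r.+1) +
    theta_coef z w r.+1 * (p ^+ (n - r) * S n r) +
    theta_coef z w r.+1 * (p ^+ (n + r).+2 * S n r.+2).
  move=> /=; rewrite ltnS => /S_double_pascal S1.
  transitivity (theta_coef z w r.+1 *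
    ((1 - p ^+ n.*2.+1) * (1 - p ^+ n.*2.+2) * S n.+1 r.+1)); first by ring.
  by rewrite S1; ring.
rewrite [X in _ = _ + X](eq_big_nat _ _ sumE) !big_split /= -mulr_sumr.
transitivity (theta_coef z w 0 *
    ((1 + p ^+ n.*2.+1) * S n 0 + 2 * p ^+ n.+1 * S n 1) +
  ((1 + p ^+ n.*2.+1) * \sum_(0 <= r < n.+1) theta_coef z w r.+1 * S n r.+1 +
   \sum_(0 <= r < n.+1) theta_coef z w r.+1 * (p ^+ (n - r) * S n r) +
   \sum_(0 <= r < n.+1) theta_coef z w r.+1 * (p ^+ (n + r).+2 * S n r.+2))).
  by rewrite [theta_coef z w 0]/theta_coef /= expr0; ring.
by rewrite -S_double_pascal0; ring.
Qed.

End Bailey.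
End Pochhammer.

(** * Convergence of formal power series *)

Section Convergence.
Variable R : comNzRingType.
Implicit Types (f g a b : fps R) (u v : nat -> fps R) (n m k N : nat).

Local Notation q := (fps_q R).

Lemma fps_coefD f g n : fps_coef (f + g) n = fps_coef f n + fps_coef g n.
Proof. by []. Qed.

Lemma fps_coefB f g n : fps_coef (f - g) n = fps_coef f n - fps_coef g n.
Proof. by []. Qed.

Lemma fps_coef_sum (I : Type) (r : seq I) (P : pred I) (F : I -> fps R) n :
  fps_coef (\sum_(i <- r | P i) F i) n = \sum_(i <- r | P i) fps_coef (F i) n.
Proof. by elim/big_rec2: _ => // i x y _ <-. Qed.

Lemma fps_coef_qX m n : fps_coef (q ^+ m) n = (n == m)%:R.
Proof.
elim: m n => [|m IHm] n; first by case: n.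
rewrite exprS -[LHS]/(\sum_(i < n.+1) fps_coef q i * fps_coef (q ^+ m) (n - i)).
case: n => [|n]; first by rewrite big_ord1 mul0r.
rewrite big_ord_recl mul0r add0r big_ord_recl mul1r /= /bump /= subn1 IHm.
by rewrite big1 ?addr0 // => i _; rewrite mul0r.
Qed.

(** Divisibility by q^k; [low k (f - g)] expresses congruence modulo q^k. *)
Definition low k f : Prop := forall i, (i < k)%N -> fps_coef f i = 0.

Lemma low_le k m f : (k <= m)%N -> low m f -> low k f.
Proof. by move=> le_km lf i lt_ik; apply/lf/(leq_trans lt_ik). Qed.

Lemma low_qX k m : (k <= m)%N -> low k (q ^+ m).
Proof.
by move=> le_km i lt_ik; rewrite fps_coef_qX (ltn_eqF (leq_trans lt_ik le_km)).
Qed.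

Lemma low_mulr k f g : low k f -> low k (f * g).
Proof.
by move=> lf; rewrite -[k]addn0; apply: fps_mul_low.
Qed.

Lemma low_mull k f g : low k f -> low k (g * f).
Proof. by rewrite mulrC; apply: low_mulr. Qed.

Lemma low_add k f g : low k f -> low k g -> low k (f + g).
Proof. by move=> lf lg i lt_ik; rewrite fps_coefD lf // lg // addr0. Qed.

Lemma low_opp k f : low k f -> low k (- f).
Proof. by move=> lf i /lf fi; rewrite -sub0r fps_coefB fi subrr. Qed.

Lemma low_sum k (I : Type) (r : seq I) (P : pred I) (F : I -> fps R) :
  (forall i, P i -> low k (F i)) -> low k (\sum_(i <- r | P i) F i).
Proof. by move=> lF n lt_nk; rewrite fps_coef_sum big1 // => i /lF ->. Qed.

Lemma eventually_forall_le (Q : nat -> nat -> Prop) n :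
  (forall k, exists N0, forall N, (N0 <= N)%N -> Q k N) ->
  exists N0, forall N, (N0 <= N)%N -> forall k, (k <= n)%N -> Q k N.
Proof.
move=> evQ; elim: n => [|n [N1 QN1]].
  have [N0 QN0] := evQ 0%N; exists N0 => N /QN0 Q0 k.
  by rewrite leqn0 => /eqP->.
have [N0 QN0] := evQ n.+1; exists (maxn N0 N1) => N.
rewrite geq_max => /andP[/QN0 Qn /QN1 Qlt] k.
by rewrite leq_eqVlt => /orP[/eqP->|/Qlt].
Qed.

Lemma cvg_coef_le u f n : fps_cvg_to u f -> exists N0, forall N, (N0 <= N)%N ->
  forall k, (k <= n)%N -> fps_coef (u N) k = fps_coef f k.
Proof. exact: eventually_forall_le. Qed.

Lemma cvg_const f : fps_cvg_to (fun=> f) f.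
Proof. by move=> n; exists 0%N. Qed.

Lemma cvg_ext u v f : u =1 v -> fps_cvg_to u f -> fps_cvg_to v f.
Proof. by move=> uv cu n; have [N0 uN] := cu n; exists N0 => N /uN; rewrite uv. Qed.

Lemma cvg_comp u f (h : nat -> nat) :
    (forall m, exists N0, forall N, (N0 <= N)%N -> (m <= h N)%N) ->
  fps_cvg_to u f -> fps_cvg_to (u \o h) f.
Proof.
move=> hh cu n; have [N0 uN] := cu n; have [N1 hN] := hh N0.
by exists N1 => N /hN /uN.
Qed.

Lemma cvgD u v f g : fps_cvg_to u f -> fps_cvg_to v g ->
  fps_cvg_to (fun N => u N + v N) (f + g).
Proof.
move=> cu cv n; have [[N0 uN] [N1 vN]] := (cu n, cv n).
exists (maxn N0 N1) => N; rewrite geq_max => /andP[/uN uE /vN vE].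
by rewrite !fps_coefD uE vE.
Qed.

Lemma cvgM u v f g : fps_cvg_to u f -> fps_cvg_to v g ->
  fps_cvg_to (fun N => u N * v N) (f * g).
Proof.
move=> cu cv n; have [N0 uN] := cvg_coef_le n cu; have [N1 vN] := cvg_coef_le n cv.
exists (maxn N0 N1) => N; rewrite geq_max => /andP[/uN uE /vN vE].
by apply: eq_bigr => -[i /=]; rewrite ltnS => le_in _; rewrite uE // vE ?leq_subr.
Qed.

Lemma cvgB u v f g : fps_cvg_to u f -> fps_cvg_to v g ->
  fps_cvg_to (fun N => u N - v N) (f - g).
Proof.
move=> cu cv; apply: cvgD cu _; have := cvgM (cvg_const (- 1)) cv.
by rewrite mulN1r; apply: cvg_ext => N; rewrite mulN1r.
Qed.

Lemma cvg_low u : (forall N, low N (u N)) -> fps_cvg_to u 0.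
Proof. by move=> lu n; exists n.+1 => N /lu. Qed.

Lemma low_cvg k u f : fps_cvg_to u f -> (forall N, low k (u N)) -> low k f.
Proof. by move=> cu lu i lt_ik; have [N uN] := cu i; rewrite -(uN N) ?lu. Qed.

Lemma cvgV u f : (forall N, u N \is a GRing.unit) -> f \is a GRing.unit ->
  fps_cvg_to u f -> fps_cvg_to (fun N => (u N)^-1) f^-1.
Proof.
move=> Uu Uf cu n; have [N0 uN] := cvg_coef_le n cu; exists N0 => N /uN uE.
apply/eqP; rewrite -subr_eq0 -fps_coefB.
have -> : (u N)^-1 - f^-1 = (f - u N) * ((u N)^-1 * f^-1).
  by rewrite mulrBl mulrCA mulrV // mulr1 mulrA mulrV // mul1r.
by rewrite (@low_mulr n.+1) // => k /uE kE; rewrite fps_coefB kE subrr.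
Qed.

(* The sum of the [t k], provided that [low k (t k)] for all [k]. *)
Definition fps_sum (t : nat -> fps R) : fps R :=
  Fps (fun n => fps_coef (\sum_(0 <= k < n.+1) t k) n).

Lemma eq_fps_sum (s t : nat -> fps R) : s =1 t -> fps_sum s = fps_sum t.
Proof. by move=> st; apply: fpsP => n /=; congr fps_coef; apply: eq_bigr. Qed.

(** Tannery's theorem, q-adically: terms with k > n never touch coefficient n, and the finitely many
    others settle together from some N on. *)
Lemma cvg_sum_dominated (t : nat -> nat -> fps R) (s : nat -> fps R) :
    (forall N k, low k (t N k)) -> (forall k, fps_cvg_to (t^~ k) (s k)) ->
  fps_cvg_to (fun N => \sum_(0 <= k < N.+1) t N k) (fps_sum s).
Proof.
move=> lt ct n; have [N0 tE] := eventually_forall_le n (fun k => ct k n).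
exists (maxn n N0) => N; rewrite geq_max => /andP[le_nN /tE tNE] /=.
rewrite (big_cat_nat (n := n.+1)) // fps_coefD !fps_coef_sum.
rewrite [X in _ + X]big_nat [X in _ + X]big1 ?addr0; last first.
  by move=> k /andP[lt_nk _]; apply: lt.
by rewrite big_nat [RHS]big_nat; apply: eq_bigr => k /= /tNE ->.
Qed.

Lemma fps_sum_cvg (t : nat -> fps R) : (forall k, low k (t k)) ->
  fps_cvg_to (fun N => \sum_(0 <= k < N.+1) t k) (fps_sum t).
Proof.
by move=> lt; apply: (cvg_sum_dominated (t := fun=> t)) => // k; apply: cvg_const.
Qed.

Lemma fpoch_cvg a b : fps_coef b 0 = 0 -> fps_cvg_to (fpoch a b) (qpoch a b).
Proof.
move=> b0; apply: cvg_ext (qpoch_cvg a b0) => N.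
rewrite /fpoch big_add1 big_mkord.
by apply: eq_bigr => i _; rewrite subSS subn0.
Qed.

Lemma fpoch_low1 k a b n : low k a -> low k (fpoch a b n - 1).
Proof.
move=> la; elim: n => [|n IHn]; first by rewrite fpoch0 subrr.
rewrite fpochS mulrBr mulr1 addrAC; apply: low_add => //.
by apply/low_opp/low_mull/low_mulr.
Qed.

Lemma qpoch_low1 k a b : fps_coef b 0 = 0 -> low k a -> low k (qpoch a b - 1).
Proof.
move=> b0 la; apply: low_cvg (cvgB (fpoch_cvg a b0) (cvg_const 1)) _ => N.
exact: fpoch_low1.
Qed.

Lemma qpochSl a b : fps_coef b 0 = 0 -> qpoch a b = (1 - a) * qpoch (a * b) b.
Proof.
move=> b0; apply: fps_cvg_unique (cvg_comp (h := S) _ (fpoch_cvg a b0)) _.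
  by move=> m; exists m => N; apply: leqW.
apply: cvg_ext (cvgM (cvg_const _) (fpoch_cvg _ b0)) => N /=.
by rewrite fpochSl.
Qed.

Lemma low1_unit f : low 1 (f - 1) -> f \is a GRing.unit.
Proof. by move=> /(_ 0%N isT)/eqP; rewrite fps_coefB subr_eq0 => /eqP /fps_unit1. Qed.

Lemma qpoch_unit a b : fps_coef b 0 = 0 -> fps_coef a 0 = 0 ->
  qpoch a b \is a GRing.unit.
Proof.
by move=> b0 a0; apply/low1_unit/qpoch_low1 => // -[].
Qed.

Lemma subX_unit (p : fps R) n : fps_coef p 0 = 0 -> 1 - p ^+ n.+1 \is a GRing.unit.
Proof.
by move=> p0; apply: fps_unit1; rewrite fps_coefB fps_exp_low // subr0.
Qed.

Lemma inv_qfact_cvg (p : fps R) : fps_coef p 0 = 0 ->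
  fps_cvg_to (inv_qfact p) (qpoch p p)^-1.
Proof.
move=> p0; apply: cvgV; last exact: fpoch_cvg.
- by move=> N; apply: fpoch_unit => n; apply: subX_unit.
- exact: qpoch_unit.
Qed.

Lemma cvg_sum_dominatedM (t : nat -> fps R) (v : nat -> nat -> fps R) f :
    (forall k, low k (t k)) -> (forall k, fps_cvg_to (v^~ k) f) ->
  fps_cvg_to (fun N => \sum_(0 <= k < N.+1) t k * v N k) (fps_sum t * f).
Proof.
move=> lt cv; have ltM g k : low k (t k * g) by apply: low_mulr.
have -> : fps_sum t * f = fps_sum (fun k => t k * f).
  apply: fps_cvg_unique (fps_sum_cvg (ltM f)).
  apply: cvg_ext (cvgM (fps_sum_cvg lt) (cvg_const f)) => N.
  by rewrite mulr_suml.
apply: (cvg_sum_dominated (t := fun N k => t k * v N k)) => // k.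
exact: cvgM (cvg_const _) (cv k).
Qed.

(** For fixed r, both [inv_qfact p (N - r)] and [inv_qfact p (N + r)] tend to 1 / (p; p)_oo. *)
Lemma bailey_pair_cvg (p : fps R) alpha beta : fps_coef p 0 = 0 ->
    (forall r, low r (alpha r)) -> bailey_pair p alpha beta ->
  fps_cvg_to beta (fps_sum alpha * (qpoch p p)^-1 ^+ 2).
Proof.
move=> p0 la ab; have cV := inv_qfact_cvg p0.
apply: cvg_ext (fun N => esym (ab N)) (cvg_sum_dominatedM la _) => r.
rewrite expr2; apply: cvgM.
  by apply: (cvg_comp (h := fun N => (N - r)%N)) cV => m; exists (m + r)%N; lia.
by apply: (cvg_comp (h := fun N => (N + r)%N)) cV => m; exists m; lia.
Qed.

End Convergence.

(** * Product formulas *)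

Section Identities.
Variable R : comNzRingType.

Local Notation q := (fps_q R).
Local Notation Vq := (inv_qfact (fps_q R)).

Let coef0_q : fps_coef q 0 = 0. Proof. by []. Qed.

Let coef0_qX n : fps_coef (q ^+ n.+1) 0 = 0. Proof. by rewrite fps_coef_qX. Qed.

Let q_unit n : 1 - q ^+ n.+1 \is a GRing.unit. Proof. exact: subX_unit. Qed.

Let low_mul_qX k m f : (k <= m)%N -> low k (q ^+ m * f).
Proof. by move=> le_km; apply/low_mulr/low_qX. Qed.

(** Times (q; q)_oo: (-q; q)_N (q; q)_N = (q^2; q^2)_N, and the dissection mod 2 recombines this
    with (q; q^2)_N into (q; q)_{2N}. *)
Lemma euler_odd_distinct : qpoch (- q) q * qpoch q (q ^+ 2) = 1.
Proof.
apply: (mulIr (qpoch_unit coef0_q coef0_q)); rewrite mul1r.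
have c2 := fpoch_cvg q (coef0_qX 1).
have c := cvg_comp (h := muln 2) _ (fpoch_cvg q coef0_q).
apply: fps_cvg_unique (c _); last by move=> m; exists m => N; lia.
apply: cvg_ext (cvgM (cvgM (fpoch_cvg _ coef0_q) c2) (fpoch_cvg q coef0_q)) => N.
rewrite /= fpoch_dissect // big_ord_recl big_ord1 expr1 mulrAC mulrC; congr (_ * _).
rewrite /fpoch -big_split; apply: eq_bigr => i _ /=.
by rewrite -exprM mulnC exprM; ring.
Qed.

(** * The first Rogers-Ramanujan identity *)

Definition rr_sum : fps R := fps_sum (fun k => q ^+ (k ^ 2) * Vq k).

(** [bailey_lemma] is applied twice to the unit pair z = 1, w = q; the limit of the resulting beta
    is then computed from its own formula and from [bailey_pair_cvg]. *)
Lemma rr_sum_theta :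
  rr_sum * qpoch q q =
  fps_sum (fun r => q ^+ (r ^ 2) * (q ^+ (r ^ 2) * theta_coef q 1 q r)).
Proof.
have UV : (qpoch q q)^-1 \is a GRing.unit by rewrite unitrV qpoch_unit.
have bp := bailey_lemma q_unit
  (bailey_lemma q_unit (finite_jacobi_triple q_unit (mul1r q))).
apply: (mulIr UV); apply: (mulIr UV); rewrite mulrK ?qpoch_unit // -[RHS]mulrA.
have c := bailey_pair_cvg coef0_q _ bp.
apply: fps_cvg_unique (c _); last by move=> r; apply: low_mul_qX; nia.
apply: cvg_ext (cvg_sum_dominatedM (v := fun N s => Vq (N - s)) _ _) => [N|k|k].
(* Since (1; q)_r = 0 for r > 0, the inner sum reduces to 1 / (q; q)_s. *)
- apply: eq_bigr => s _; rewrite big_nat_recl // big_nat big1 => [|r _]; last first.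
    by rewrite fpochSl subrr mul0r mulr0 mul0r mulr0.
  by rewrite subn0 !fpoch0 inv_qfact0 !mulr1 mul1r addr0 mulrAC.
- by apply: low_mul_qX; nia.
- apply: (cvg_comp (h := fun N => (N - k)%N)) (inv_qfact_cvg coef0_q) => m.
  by exists (m + k)%N; lia.
Qed.

Lemma jacobi_triple (p z w : fps R) : z * w = p ->
    fps_coef z 0 = 0 -> fps_coef w 0 = 0 ->
    (forall r, low r (theta_coef p z w r)) ->
  fps_sum (theta_coef p z w) = qpoch z p * qpoch w p * qpoch p p.
Proof.
move=> zw z0 w0 lt; have p0 : fps_coef p 0 = 0.
  by rewrite -zw [LHS]big_ord1 z0 mul0r.
have Up := qpoch_unit p0 p0; have UV : (qpoch p p)^-1 \is a GRing.unit.
  by rewrite unitrV.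
apply: (mulIr UV); rewrite mulrK //; apply: (mulIr UV); rewrite -[LHS]mulrA.
have bp := finite_jacobi_triple (fun n => subX_unit n p0) zw.
apply: fps_cvg_unique (bailey_pair_cvg p0 lt bp) _.
have cV := cvg_comp (h := double) _ (inv_qfact_cvg p0).
apply: cvg_ext (cvgM (cvgM (fpoch_cvg z p0) (fpoch_cvg w p0)) (cV _)) => [N|m].
  by rewrite /=; ring.
by exists m; lia.
Qed.

(** The theta series has base q^5 with z = q^2, w = q^3, so the triple product gives (q^2, q^3, q^5;
    q^5)_oo; in (q; q)_oo dissected mod 5 the residues 1 and 4 remain. *)
Lemma rogers_ramanujan : rr_sum * (qpoch q (q ^+ 5) * qpoch (q ^+ 4) (q ^+ 5)) = 1.
Proof.
have thetaE r : q ^+ (r ^ 2) * (q ^+ (r ^ 2) * theta_coef q 1 q r) =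
    theta_coef (q ^+ 5) (q ^+ 2) (q ^+ 3) r.
  rewrite /theta_coef expr1n -!exprM; case: eqP => [->|_]; first by rewrite !mul1r.
  (* Both sides are (5r^2 - r)/2. *)
  have r2 : (2 * r + 5 * 'C(r, 2) = r ^ 2 + r ^ 2 + 'C(r, 2))%N.
    by elim: r => // r; rewrite binS bin1; nia.
  have -> : (-1) ^+ r * q ^+ (5 * 'C(r, 2)) * (q ^+ (2 * r) + q ^+ (3 * r)) =
      (-1) ^+ r * (q ^+ (2 * r + 5 * 'C(r, 2)) * (1 + q ^+ r)).
    by rewrite exprD (_ : 3 * r = 2 * r + r)%N ?exprD; [ring | lia].
  by rewrite r2 !exprD; ring.
have q5 : fps_coef (q ^+ 5) 0 = 0 by exact: coef0_qX.
apply: (mulIr (qpoch_unit coef0_q coef0_q)); rewrite mul1r mulrAC rr_sum_theta.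
rewrite (eq_fps_sum thetaE) jacobi_triple -?exprD // ?coef0_qX; last first.
  by move=> r; rewrite -thetaE; apply: low_mul_qX; nia.
have c := cvg_comp (h := muln 5) _ (fpoch_cvg q coef0_q).
apply: fps_cvg_unique (c _); last by move=> m; exists m => N; lia.
have cvg5 a : fps_cvg_to (fpoch a (q ^+ 5)) (qpoch a (q ^+ 5)) := fpoch_cvg a q5.
apply: cvg_ext (cvgM (cvgM (cvgM (cvg5 _) (cvg5 _)) (cvg5 _))
  (cvgM (cvg5 _) (cvg5 _))) => N.
rewrite /= fpoch_dissect // !big_ord_recl big_ord0 /=.
by rewrite expr1; ring.
Qed.

(** * The q-difference equation and its solution *)

Definition qpi m := qpoch (- q ^+ m) q.

Lemma qpiS m : qpi m = (1 + q ^+ m) * qpi m.+1.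
Proof. by rewrite /qpi qpochSl // opprK mulNr -exprSr. Qed.

Lemma qpi_low1 m : low m (qpi m - 1).
Proof. by apply: qpoch_low1 => //; apply/low_opp/low_qX. Qed.

Definition gterm j k : fps R :=
  q ^+ (k ^ 2 + j * k) * (fpoch (- q) q k * Vq k) * qpi (k + j).

(* The value e(q^j). *)
Definition gsum j : fps R := fps_sum (gterm j).

Let gterm_low j k : low k (gterm j k).
Proof. by rewrite /gterm -mulrA; apply: low_mul_qX; nia. Qed.

(* Summing [certE] over k telescopes; the shape of [cert] was found by
   undetermined coefficients. *)
Let cert j k : fps R :=
  - (q ^+ (k ^ 2 + j * k) * (fpoch (- q) q k * Vq k) * (1 - q ^+ k) * qpi (k + j).+2).

Let certE j k :
  gterm j k - (1 + q ^+ j + q ^+ j.+1) * gterm j.+1 k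
    + q ^+ j.*2.+2 * gterm j.+2 k - q ^+ j.+2 * (1 - q ^+ j.+1) * gterm j.+3 k =
  cert j k.+1 - cert j k.
Proof.
have qV : (1 - q ^+ k.+1) * Vq k.+1 = Vq k by rewrite -inv_qfactS.
have -> : cert j k.+1 = - (q ^+ (k ^ 2 + j * k) * q ^+ (k.*2.+1 + j) *
    (fpoch (- q) q k * (1 + q ^+ k.+1) * Vq k) * qpi (k + j).+3).
  rewrite /cert -qV fpochS -exprD (_ : (k.+1 ^ 2 + j * k.+1 =
    k ^ 2 + j * k + (k.*2.+1 + j)))%N; last by nia.
  by rewrite addSn mulNr -exprS; ring.
rewrite /cert /gterm !mulSn !addnS.
(* All infinite products are reduced to [qpi (k + j).+3], the one in [gterm j.+3 k]; a polynomial
   identity in q^j, q^k and q remains. *)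
rewrite [qpi (k + j)]qpiS [qpi (k + j).+1]qpiS [qpi (k + j).+2]qpiS.
rewrite -!muln2 !(exprS, exprD, exprM).
ring.
Qed.

(** The partial sums of [certE] telescope to [cert j N.+1], because [cert j 0] contains 1 - q^0 = 0;
    this remainder is divisible by q^N and tends to 0. *)
Lemma gsum_rec j :
  gsum j = (1 + q ^+ j + q ^+ j.+1) * gsum j.+1
    - q ^+ j.*2.+2 * gsum j.+2 + q ^+ j.+2 * (1 - q ^+ j.+1) * gsum j.+3.
Proof.
pose F j1 N := \sum_(0 <= k < N.+1) gterm j1 k.
have cE j1 : fps_cvg_to (F j1) (gsum j1) by apply: fps_sum_cvg.
have cM a j1 := cvgM (cvg_const a) (cE j1).
apply/eqP; rewrite -subr_eq0; apply/eqP.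
have c := cvgB (cE j) (cvgD (cvgB (cM (1 + q ^+ j + q ^+ j.+1) j.+1)
  (cM (q ^+ j.*2.+2) j.+2)) (cM (q ^+ j.+2 * (1 - q ^+ j.+1)) j.+3)).
apply: fps_cvg_unique c (cvg_low _) => N.
have -> : F j N - ((1 + q ^+ j + q ^+ j.+1) * F j.+1 N -
    q ^+ j.*2.+2 * F j.+2 N + q ^+ j.+2 * (1 - q ^+ j.+1) * F j.+3 N) =
    cert j N.+1.
  transitivity (cert j N.+1 - cert j 0); last first.
    by rewrite {2}/cert expr0 subrr mulr0 mul0r oppr0 subr0.
  rewrite -telescope_sumr // -(eq_bigr _ (fun k _ => certE j k)).
  by rewrite !(sumrB, big_split) /= -!mulr_sumr /F; ring.
by apply: low_opp; rewrite -!mulrA; apply: low_mul_qX; nia.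
Qed.

(** Only the term k = 0 counts modulo q^(j+1). This is the initial condition that goes with the
    q-difference equation. *)
Lemma gsum_low j : low j.+1 (gsum j - 1 - q ^+ j).
Proof.
have c := cvgB (cvgB (fps_sum_cvg (gterm_low j)) (cvg_const 1)) (cvg_const (q ^+ j)).
apply: low_cvg c _ => N; rewrite big_nat_recl //.
have -> : gterm j 0 = (1 + q ^+ j) * qpi j.+1.
  by rewrite /gterm muln0 fpoch0 inv_qfact0 add0n qpiS !mul1r.
rewrite (_ : _ - _ - _ = (1 + q ^+ j) * (qpi j.+1 - 1) +
    \sum_(0 <= k < N) gterm j k.+1); last by ring.
apply: low_add; first exact/low_mull/qpi_low1.
by apply: low_sum => k _; rewrite /gterm -mulrA; apply: low_mul_qX; nia.
Qed.

(** Termwise: [qpi k] - q^k [qpi k.+1] = [qpi k.+1], which (-q; q)_k completes to [qpi 1]. *)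
Lemma gsum01 : gsum 0 - gsum 1 = rr_sum * qpi 1.
Proof.
have lt k : low k (q ^+ (k ^ 2) * Vq k) by apply: low_mul_qX; nia.
have c := cvgM (fps_sum_cvg lt) (cvg_const (qpi 1)).
have c01 := cvgB (fps_sum_cvg (gterm_low 0)) (fps_sum_cvg (gterm_low 1)).
apply: fps_cvg_unique c01 (cvg_ext _ c) => N.
rewrite -sumrB mulr_suml; apply: eq_bigr => k _.
have -> : qpi 1 = fpoch (- q) q k * qpi k.+1.
  elim: k => [|k ->]; first by rewrite fpoch0 mul1r.
  by rewrite fpochS qpiS mulNr opprK exprS mulrA.
rewrite /gterm mul0n mul1n !addn0 addn1 [qpi k]qpiS exprD; ring.
Qed.

Lemma gsum_product :
  gsum 0 - gsum 1 =
  1 / (qpoch q (q ^+ 2) * qpochs [:: q ^+ 1; q ^+ 4] (q ^+ 5)).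
Proof.
rewrite /qpochs big_cons big_seq1 expr1 gsum01.
set a := qpoch q (q ^+ 2); set b := (X in _ / (_ * X)).
have Ea : qpi 1 * a = 1 by rewrite /qpi expr1 euler_odd_distinct.
have Eb : rr_sum * b = 1 := rogers_ramanujan.
have Eab : rr_sum * qpi 1 * (a * b) = 1.
  by rewrite [a * b]mulrC mulrACA Eb Ea mulr1.
have Uab : a * b \is a GRing.unit.
  by apply/unitrPr; exists (rr_sum * qpi 1); rewrite mulrC.
by apply: (mulIr Uab); rewrite mulrVK.
Qed.

End Identities.

(** * Counting colored partitions *)

Local Open Scope nat_scope.
Local Open Scope mset_scope.

(* The library equality of [color] does not compute. *)
Lemma color_eqE (c c' : color) : (c == c') =
  match c, c' with
  | Red, Red | Green, Green | Blue, Blue => true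
  | _, _ => false
  end.
Proof. by case: c; case: c'; apply/eqP. Qed.

(** * Partitions as words accepted by an automaton *)

Definition compatible d (x y : option color) : bool :=
  match x, y with
  | Some c, Some c' => (c, d, c') \notin forbidden_pairs
  | _, _ => true
  end.

Lemma compatible_Some d c c' : compatible d (Some c) (Some c') =
  match c, c' with
  | (Red | Green), Red => (d != 1) && (d != 2)
  | (Red | Green), Blue | Blue, (Red | Green) => d != 1
  | (Red | Green), Green | Blue, Blue => true
  end.
Proof.
rewrite /compatible /forbidden_pairs !inE !xpair_eqE !color_eqE.
by case: c; case: c'; case: d => [|[|[|d]]].
Qed.

(* A partition is encoded by the word whose letter number [j] is the color of
   its part of size [j], if any; [x] and [y] are the two letters before [w]. *)
Fixpoint accept (x y : option color) (w : seq (option color)) : bool :=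
  if w is l :: w' then [&& compatible 2 x l, compatible 1 y l & accept y l w']
  else true.

Definition letters : seq (option color) :=
  [:: None; Some Red; Some Green; Some Blue].

Lemma mem_letters l : l \in letters.
Proof. by case: l => [[]|]; rewrite !inE eqxx ?orbT. Qed.

Lemma letters_uniq : uniq letters.
Proof. by rewrite /= !inE !negb_or; do !(apply/andP; split) => //; apply/eqP. Qed.

Fixpoint words n : seq (seq (option color)) :=
  if n is n'.+1 then [seq l :: w | l <- letters, w <- words n'] else [:: [::]].

Lemma words_uniq n : uniq (words n).
Proof.
elim: n => // n IHn; apply: allpairs_uniq => //; first exact: letters_uniq.
by move=> [l w] [l' w'] _ _ /= [-> ->].
Qed.

Lemma mem_words n w : (w \in words n) = (size w == n).
Proof.
elim: n w => [|n IHn] w; first by rewrite inE; case: w.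
apply/allpairsP/idP => [[[l w'] [_ w'_in ->]]|].
  by rewrite /= eqSS -IHn.
case: w => // l w; rewrite /= eqSS -IHn => w_in.
by exists (l, w); rewrite mem_letters.
Qed.

Definition letter_weight j (l : option color) := if l is Some _ then j else 0.

Fixpoint word_weight j (w : seq (option color)) :=
  if w is l :: w' then letter_weight j l + word_weight j.+1 w' else 0.

(** * Generating functions of the accepted words *)

Section GeneratingFunction.
Variable R : comNzRingType.
Local Open Scope ring_scope.

Local Notation q := (fps_q R).
Local Notation e := (gsum R).

(** Here j is the size of the first letter of the word, so x and y have sizes j - 2 and j - 1;
    [state_gf x y j] thus corresponds to [word_gf x y n j.+1]. *)
Definition word_gf x y n j : fps R :=
  \sum_(w <- words n | accept x y w) q ^+ word_weight j w.

Lemma word_gfS x y n j :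
  word_gf x y n.+1 j =
  \sum_(l <- letters | compatible 2 x l && compatible 1 y l)
    q ^+ letter_weight j l * word_gf y l n j.+1.
Proof.
rewrite /word_gf -[words n.+1]/[seq l :: w | l <- letters, w <- words n].
rewrite big_mkcond /allpairs_dep big_flatten big_map [RHS]big_mkcond.
apply: eq_bigr => l _; rewrite big_map.
under eq_bigr => w do rewrite [accept _ _ _]/= andbA.
case: (compatible 2 x l && compatible 1 y l); last by rewrite big1.
rewrite [in RHS]big_mkcond mulr_sumr; apply: eq_bigr => w _.
by case: (accept y l w); rewrite ?mulr0 // exprD.
Qed.

(* The parts are larger than [j]; [x] and [y] are the letters of sizes [j - 1]
   and [j]. *)
Definition state_gf (x y : option color) j : fps R :=
  match y with
  | Some Blue => e j - q ^+ j * e j.+1 - q ^+ j.+1 * e j.+2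
  | Some _ => e j.+1
  | None =>
    match x with
    | Some Red | Some Green => e j - q ^+ j * e j.+1
    | _ => e j - q ^+ j * e j.+1 + q ^+ j.+1 * e j.+2
    end
  end.

(** The closed forms solve the linear system of the automaton. Red may follow no part of the
    preceding size, so x matters only when y is [None], which leaves four states. *)
Lemma state_gfS x y j :
  state_gf x y j =
  \sum_(l <- letters | compatible 2 x l && compatible 1 y l)
    q ^+ letter_weight j.+1 l * state_gf y l j.+1.
Proof.
rewrite big_mkcond !big_cons big_nil.
have := gsum_rec R j; rewrite -muln2 !(exprS, exprM) /= => e_rec.
case: y => [[]|]; case: x => [[]|]; rewrite ?compatible_Some /= ?exprS ?expr0;
  move: (q ^+ j) (e j) (e j.+1) (e j.+2) (e j.+3) e_rec => x e0 e1 e2 e3;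
  (* After red or green the equation is an identity in the e's; after blue or [None] it is the
     q-difference equation. *)
  by [move=> _; ring | move=> ->; ring].
Qed.

(** Base case for comparison with words: the smallest possible part is j + 1, so only the empty
    partition counts modulo q^(j+1). *)
Lemma state_gf_low1 x y j : low j.+1 (state_gf x y j - 1).
Proof.
have [g0 g1] := (@gsum_low R j, @gsum_low R j.+1).
have lq (f : fps R) : low j.+1 (q ^+ j.+1 * f) by apply/low_mulr/low_qX.
have c1 : low j.+1 (e j.+1 - 1).
  rewrite -[_ - 1](subrK (q ^+ j.+1)); apply: low_add; last exact: low_qX.
  exact: low_le (leqnSn _) g1.
have b1 : low j.+1 (e j - q ^+ j * e j.+1 - 1).
  have -> : e j - q ^+ j * e j.+1 - 1 =
    (e j - 1 - q ^+ j) - q ^+ j * (e j.+1 - 1) by ring.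
  by apply: low_add => //; apply/low_opp/low_mull.
have a1 := low_add b1 (lq (e j.+2)).
have d1 := low_add b1 (low_opp (lq (e j.+2))).
case: y => [[]|]; rewrite /state_gf; [exact: c1 | exact: c1 | | ].
  by rewrite addrAC; exact: d1.
by case: x => [[]|]; [exact: b1 | exact: b1 | |]; rewrite addrAC; exact: a1.
Qed.

(** Both families obey the same one-letter recursion, and each letter read improves the agreement by
    one power of q. *)
Lemma state_gf_word_gf x y n j :
  low (j + n).+1 (state_gf x y j - word_gf x y n j.+1).
Proof.
elim: n x y j => [|n IHn] x y j.
  by rewrite addn0 /word_gf big_cons big_nil addr0 expr0; apply: state_gf_low1.
rewrite state_gfS word_gfS -sumrB; apply: low_sum => l _.
by rewrite -mulrBr; apply: low_mull; rewrite addnS -addSn.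
Qed.

Lemma coef_word_gf x y n j m :
  fps_coef (word_gf x y n j) m =
  (count (fun w => accept x y w && (word_weight j w == m)) (words n))%:R.
Proof.
rewrite fps_coef_sum -sum1_count natr_sum big_mkcondr.
by apply: eq_bigr => w _; rewrite fps_coef_qX eq_sym; case: eqP.
Qed.

End GeneratingFunction.

(** * The correspondence between words and multisets *)

Fixpoint word_parts j (w : seq (option color)) : seq part :=
  if w is l :: w' then
    if l is Some c then (j, c) :: word_parts j.+1 w' else word_parts j.+1 w'
  else [::].

Lemma mem_word_parts j w i c :
  ((i, c) \in word_parts j w) = (j <= i) && (nth None w (i - j) == Some c).
Proof.
elim: w j => [|l w IHw] j; first by rewrite nth_nil andbF.
have [lt_ij|lt_ji|<-] := ltngtP i j.
- have IHf : ((i, c) \in word_parts j.+1 w) = false.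
    by rewrite IHw ltnNge ltnW.
  case: l => [c'|] /=; rewrite ?inE ?IHf //.
  by rewrite xpair_eqE (ltn_eqF lt_ij).
- have -> : i - j = (i - j.+1).+1 by lia.
  case: l => [c'|] /=; rewrite ?inE IHw lt_ji //.
  by rewrite xpair_eqE (gtn_eqF lt_ji).
- have IHf : ((i, c) \in word_parts i.+1 w) = false by rewrite IHw ltnn.
  by rewrite subnn; case: l => [c'|] /=; rewrite ?inE IHf // xpair_eqE eqxx orbF eq_sym.
Qed.

Lemma word_parts_uniq j w : uniq (word_parts j w).
Proof.
elim: w j => // -[c|] w IHw j //=.
by rewrite IHw mem_word_parts ltnn.
Qed.

Lemma word_parts_weight j w : \sum_(x <- word_parts j w) x.1 = word_weight j w.
Proof.
elim: w j => [|[c|] w IHw] j; first by rewrite big_nil.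
  by rewrite /= big_cons IHw.
exact: IHw.
Qed.

(** Prefixing w with x and y makes index i point two places, or one, before letter i of w; beyond
    the end the default [None] is compatible with everything. *)
Lemma acceptP x y w :
  reflect (forall i, compatible 2 (nth None (x :: y :: w) i) (nth None w i) &&
                     compatible 1 (nth None (y :: w) i) (nth None w i))
    (accept x y w).
Proof.
elim: w x y => [|l w IHw] x y.
  have nthN i : nth None [::] i = None :> option color by rewrite nth_nil.
  by left=> i; rewrite nthN /compatible; case: (nth _ _ _); case: (nth _ _ _).
rewrite /=; apply: (iffP and3P) => [[xl yl /IHw acc] [|i]|acc].
- by rewrite /= xl yl.
- exact: acc.
- have /andP[xl yl] := acc 0; split=> //.
  by apply/IHw => i; apply: (acc i.+1).
Qed.

Definition word_mset w : {mset part} := seq_mset (word_parts 1 w).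

Lemma word_msetE w x : word_mset w x = (x \in word_parts 1 w).
Proof. by rewrite mset_seqE count_uniq_mem ?word_parts_uniq. Qed.

Lemma mem_word_mset w i c :
  ((i, c) \in word_mset w) = (0 < i) && (nth None w i.-1 == Some c).
Proof. by rewrite -mset_gt0 word_msetE mem_word_parts subn1 lt0b. Qed.

Lemma weight_word_mset w : weight (word_mset w) = word_weight 1 w.
Proof.
by rewrite /weight (perm_big _ (perm_eq_seq_mset _)) word_parts_weight.
Qed.

(** The common length matters: a trailing [None] changes the word but not the partition. *)
Lemma word_mset_inj n : {in words n &, injective word_mset}.
Proof.
move=> w w'; rewrite !mem_words => /eqP sw /eqP sw' eq_ww'.
apply: (@eq_from_nth _ None) => [|i _]; first by rewrite sw sw'.
have nthE c : (nth None w i == Some c) = (nth None w' i == Some c).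
  by rewrite -[LHS](mem_word_mset w i.+1) -[RHS](mem_word_mset w' i.+1) eq_ww'.
case: (nth None w i) nthE => [c|] nthE.
  by apply/esym/eqP; rewrite -nthE.
by case: (nth None w' i) nthE => // c /(_ c)/esym/eqP.
Qed.

Lemma compatibleP d x y :
  reflect (forall c c', x = Some c -> y = Some c' ->
             (c, d, c') \notin forbidden_pairs)
    (compatible d x y).
Proof.
apply: (iffP idP) => [xy c c' xc yc|]; first by move: xy; rewrite xc yc.
by case: x y => [c|] [c'|] //; apply.
Qed.

(* A fictitious red part of size -1 forbids exactly the part 1_R. *)
Lemma word_mset_Gamma w :
  Gamma (word_mset w) /\ (1, Red) \notin word_mset w <-> accept (Some Red) None w.
Proof.
split=> [[[_ _ no_pair] no1R]|/acceptP acc].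
  have compat d k : compatible d (nth None w k) (nth None w (k + d)).
    apply/compatibleP => c c' kc kdc'; apply/negP => /(@no_pair k.+1 _ _ _ isT).
    by case; rewrite !mem_word_mset addSn /= kc kdc' !eqxx.
  apply/acceptP => i; apply/andP; split.
    case: i => [|[|k]] //; last by have := compat 2 k; rewrite addn2.
    apply/compatibleP => c c' [<-] w0; move: no1R.
    rewrite mem_word_mset w0 -[_ \notin forbidden_pairs]/(compatible _ (Some _) (Some _)).
    by rewrite compatible_Some; case: c' {w0} => //; rewrite !eqxx.
  by case: i => [|k] //; have := compat 1 k; rewrite addn1.
have compat d j c c' : 1 <= j -> (d == 1) || (d == 2) ->
    (j, c) \in word_mset w -> (j + d, c') \in word_mset w ->
  (c, d, c') \notin forbidden_pairs.
  case: j => // j _ d12; rewrite !mem_word_mset addSn /= => /eqP jc /eqP jdc'.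
  have /andP[acc2 acc1] := acc (j + d).
  case/orP: d12 acc1 acc2 jdc' => /eqP->; rewrite ?addn1 ?addn2 /= jc.
    by move=> acc1 _ jc'; rewrite jc' in acc1.
  by move=> _ acc2 jc'; rewrite jc' in acc2.
split; last first.
  have acc0 : compatible 2 (Some Red) (nth None w 0) by case/andP: (acc 0).
  rewrite mem_word_mset; apply: contraL acc0 => /andP[_ /eqP ->].
  by rewrite compatible_Some.
split=> [[i c]|j j_gt0|j c d c' j_gt0 cdc' [jc jdc']].
- by rewrite mem_word_mset => /andP[].
- rewrite !word_msetE !mem_word_parts j_gt0 /=.
  by case: (nth None w (j - 1)) => [[]|]; rewrite ?(inj_eq Some_inj) ?color_eqE.
- apply/negP: (cdc'); apply: compat j_gt0 _ jc jdc'.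
  move: cdc'; rewrite !inE !xpair_eqE.
  by case: (d == 1); case: (d == 2); rewrite ?orbT // !andbF.
Qed.

(** Each size carries at most one part, so its color is a function of the size, and no part exceeds
    the weight, so n letters suffice. *)
Lemma Gamma_word_mset n p : Gamma p -> weight p = n ->
  exists2 w, w \in words n & word_mset w = p.
Proof.
move=> [p_gt0 p_uniq _] wp.
pose letter j := if (j, Red) \in p then Some Red else
  if (j, Green) \in p then Some Green else
  if (j, Blue) \in p then Some Blue else None.
exists (mkseq (fun i => letter i.+1) n); first by rewrite mem_words size_mkseq.
apply/msetP => -[i c]; rewrite word_msetE mem_word_parts.
case: i => [|i] /=.
  by apply/esym/mset_eq0P; apply/negP => /p_gt0.
rewrite subn1 /=; have [lt_in|le_ni] := ltnP i n; last first.
  rewrite nth_default ?size_mkseq //; apply/esym/mset_eq0P; apply/negP => pi.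
  suff : i.+1 <= weight p by rewrite wp ltnNge le_ni.
  by rewrite /weight (big_rem _ pi) leq_addr.
rewrite nth_mkseq // /letter; have := p_uniq i.+1 isT.
rewrite !in_mset.
(* The bound on the sum leaves at most one multiplicity equal to 1, so the order of the tests in
   [letter] is immaterial. *)
case: c; move: (p (i.+1, Red)) (p (i.+1, Green)) (p (i.+1, Blue));
  move=> [|[|r]] [|[|g]] [|[|b]] //= _;
  by rewrite ?(inj_eq Some_inj) ?color_eqE.
Qed.

(** [word_mset] is a bijection from the accepted words of length n and weight n onto
    [Gamma_no1R n]. *)
Lemma A_count n : A n =
  count (fun w => accept (Some Red) None w && (word_weight 1 w == n)) (words n).
Proof.
rewrite /A -size_filter; set s := filter _ _.
have -> : Gamma_no1R n = [set` seq_fset tt (map word_mset s)]%classic.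
  apply/seteqP; split=> p;
    rewrite -[[set` _]%classic p]/(is_true (p \in seq_fset tt _)) seq_fsetE.
    case=> Gp wp no1R; have [w w_in def_p] := Gamma_word_mset Gp wp.
    apply/mapP; exists w => //; rewrite mem_filter w_in andbT.
    rewrite -weight_word_mset def_p wp eqxx andbT.
    by apply/word_mset_Gamma; rewrite def_p.
  case/mapP => w; rewrite mem_filter => /andP[/andP[acc /eqP wn] _] ->.
  have [Gw no1R] := (word_mset_Gamma w).2 acc.
  by split; rewrite ?weight_word_mset.
rewrite set_fsetK size_seq_fset undup_id ?size_map // map_inj_in_uniq.
  by rewrite filter_uniq ?words_uniq.
by move=> w w'; rewrite !mem_filter => /andP[_ w_in] /andP[_ w'_in];
  exact: word_mset_inj w_in w'_in.
Qed.

Local Open Scope ring_scope.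

Theorem theorem1 :
  let q := fps_q int in
  Fps (fun n : nat => (A n)%:R : int) =
    1 / (qpoch q (q ^+ 2) * qpochs [:: q ^+ 1; q ^+ 4] (q ^+ 5)).
Proof.
move=> q; rewrite -gsum_product; apply: fpsP => n; rewrite [LHS]/=.
rewrite A_count -coef_word_gf.
(* The initial state, fictitious red at -1 and nothing at 0, has series e(1) - e(q); agreement
   modulo q^(n+1) just reaches coefficient n. *)
have := @state_gf_word_gf int (Some Red) None n 0 n (leqnn _).
by rewrite fps_coefB /state_gf expr0 mul1r => /eqP; rewrite subr_eq0 => /eqP ->.
Qed.
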